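(* A class of graphs has bounded treewidth if and only if it is distance-$\infty$ deletion-breakable.
   Context: A class $\mathcal{C}$ is distance-$\infty$ deletion-breakable if there exist a function $N:\mathbb{N}\to\mathbb{N}$ and a constant $k$ such that for all $m\in\mathbb{N}$, $G\in\mathcal{C}$ and $W\subseteq V(G)$ with $|W|\ge N(m)$ there exist a set $S\subseteq V(G)$ with $|S|\le k$ and subsets $A,B\subseteq W\setminus S$ with $|A|,|B|\ge m$ such that in $G-S$ no $a\in A$ and $b\in B$ lie in the same connected component. Treewidth is the standard graph parameter. *)

(* Defs.v *)
From mathcomp Require Import all_boot.
From mathcomp Require Import boolp.

Set Implicit Arguments.
Unset Strict Implicit.
Unset Printing Implicit Defensive.

Record sgraph := SGraph {
  vertex :> finType;
  adj : rel vertex;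
  adj_sym : symmetric adj;
  adj_irr : irreflexive adj
}.

Definition graph_class := sgraph -> Prop.

(* Adjacency of the induced subgraph G[X], kept as a relation on all of G:
   vertices outside X are isolated. For x, y in X, [connect (adj_in X) x y]
   says that x and y lie in the same connected component of G[X]. *)
Definition adj_in (G : sgraph) (X : {set G}) : rel G :=
  [rel x y | [&& x \in X, y \in X & adj x y]].

Definition connected_in (G : sgraph) (X : {set G}) : Prop :=
  {in X &, forall x y, connect (adj_in X) x y}.

(* [ucycle] also accepts the closed walks [:: x; y] along an edge, which are
   not cycles of a simple graph. *)
Definition acyclic (G : sgraph) : Prop :=
  forall c : seq G, ucycle (@adj G) c -> size c <= 2.

Definition is_tree (T : sgraph) : Prop :=
  [/\ 0 < #|T|, connected_in [set: T] & acyclic T].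

Record tree_decomposition (G T : sgraph) (bag : T -> {set G}) : Prop := {
  td_tree : is_tree T;
  td_vertex : forall v : G, exists t : T, v \in bag t;
  td_edge : forall u v : G, adj u v ->
    exists t : T, (u \in bag t) && (v \in bag t);
  td_connected : forall v : G, connected_in [set t | v \in bag t]
}.

(* The predecessor is truncated: the graph without vertices gets width 0
   instead of -1. *)
Definition width (G T : sgraph) (bag : T -> {set G}) : nat :=
  (\max_(t : T) #|bag t|).-1.

Definition has_decomposition_of_width (G : sgraph) (w : nat) : Prop :=
  exists (T : sgraph) (bag : T -> {set G}),
    tree_decomposition bag /\ width bag = w.

Definition one_vertex_graph : sgraph :=
  @SGraph unit (fun _ _ => false) (fun _ _ => erefl) (fun _ => erefl).

Lemma exists_decomposition (G : sgraph) :
  exists w, `[< has_decomposition_of_width G w >].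
Proof.
pose bag (t : one_vertex_graph) := [set: G].
exists (width bag); apply/asboolP; exists one_vertex_graph, bag.
split=> //; split=> [|v|u v _|v].
- split; first by rewrite card_unit.
  + by move=> [] [] _ _; apply: connect0.
  + by move=> c /andP[_ /card_uniqP <-]; rewrite (leq_trans (max_card _)) ?card_unit.
- by exists tt; rewrite inE.
- by exists tt; rewrite !inE.
- by move=> [] [] _ _; apply: connect0.
Qed.

Definition treewidth (G : sgraph) : nat := ex_minn (exists_decomposition G).

Definition bounded_treewidth (C : graph_class) : Prop :=
  exists k : nat, forall G : sgraph, C G -> treewidth G <= k.

(* Distance-infinity deletion-breakability; G - S is G[~: S]. *)
Definition infty_deletion_breakable (C : graph_class) : Prop :=
  exists (N : nat -> nat) (k : nat),
    forall (m : nat) (G : sgraph) (W : {set G}), C G -> N m <= #|W| ->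
      exists S A B : {set G},
        [/\ #|S| <= k,
            A \subset W :\: S, B \subset W :\: S, m <= #|A| & m <= #|B|]
        /\ {in A & B, forall a b, ~~ connect (adj_in (~: S)) a b}.

(* Main.v *)
(* If every node of a tree decomposition had a branch carrying more than half
   of W, take a smallest such branch, at t say, and its neighbour s of t: the
   heavy branch at s meets the one at t, hence, edges of a tree being bridges,
   is strictly contained in it. So some bag leaves no heavy branch, and its
   branches can be grouped into two sides that both contain many vertices of W.

   Conversely, let n = N(k+1). A part U of G that meets the part X already
   decomposed in at most n vertices, all in one bag, is decomposed by induction
   on |U|: enlarge U :&: X to W with n elements, separate W by S, hang a new
   leaf with bag W :|: S (restricted to U), and recurse on the two sides
   together with S. Each side loses at least k+1 elements of W and gains at most
   k elements of S, so its interface with the new bag has again at most n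
   vertices. Growing the tree by leaves only makes it easy to keep it a tree. *)
From mathcomp Require Import all_boot.
From mathcomp Require Import zify boolp.
Require Import Defs.

Set Implicit Arguments.
Unset Strict Implicit.
Unset Printing Implicit Defensive.

(** * Connectivity in induced subgraphs *)

Lemma homo_connect (S T : finType) (f : S -> T) (e : rel S) (e' : rel T) :
  {homo f : x y / e x y >-> e' x y} ->
  {homo f : x y / connect e x y >-> connect e' x y}.
Proof.
move=> fe x _ /connectP[p ep ->]; apply/connectP; exists (map f p).
  exact: homo_path ep.
by rewrite last_map.
Qed.

Lemma adj_inE (G : sgraph) (X : {set G}) (x y : G) :
  adj_in X x y = [&& x \in X, y \in X & adj x y].
Proof. by []. Qed.

Lemma connect_adj_in_sym (G : sgraph) (X : {set G}) : connect_sym (adj_in X).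
Proof.
by apply: sym_connect_sym => x y; rewrite !adj_inE adj_sym andbCA.
Qed.

Lemma connect_adj_inS (G : sgraph) (X Y : {set G}) : X \subset Y ->
  subrel (connect (adj_in X)) (connect (adj_in Y)).
Proof.
move=> /subsetP sXY; apply: connect_sub => x y /and3P[xX yX xy].
by apply: connect1; rewrite adj_inE !sXY.
Qed.

(** * Attaching a leaf to a tree and to a partial decomposition *)

Definition leaf_adj (T : sgraph) (t : T) : rel (option T) :=
  fun x y => match x, y with
  | Some a, Some b => adj a b
  | Some a, None | None, Some a => a == t
  | None, None => false
  end.

Lemma leaf_adj_sym (T : sgraph) (t : T) : symmetric (leaf_adj t).
Proof. by case=> [a|] [b|] //=; rewrite adj_sym. Qed.

Lemma leaf_adj_irr (T : sgraph) (t : T) : irreflexive (leaf_adj t).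
Proof. by case=> [a|] //=; rewrite adj_irr. Qed.

Definition add_leaf (T : sgraph) (t : T) : sgraph :=
  SGraph (leaf_adj_sym t) (leaf_adj_irr t).

(** Used with [Y] the whole tree and with [Y] the nodes whose bag holds a given vertex; the case
    [X = set0] is a vertex occurring only in the new bag. *)
Lemma connected_add_leaf (T : sgraph) (t : T) (X : {set T})
    (Y : {set add_leaf t}) :
  connected_in X -> (forall x, (Some x \in Y) = (x \in X)) ->
  (None \in Y -> t \in X \/ X = set0) -> connected_in Y.
Proof.
move=> cX YX YN.
have cS x y : x \in X -> y \in X ->
    connect (@adj_in (add_leaf t) Y) (Some x) (Some y).
  move=> xX yX; apply: (@homo_connect T (add_leaf t) Some (adj_in X)).
    by move=> a b; rewrite !adj_inE !YX.
  exact: cX.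
have cN x : None \in Y -> x \in X ->
    connect (@adj_in (add_leaf t) Y) None (Some x).
  move=> NY xX; have [tX|X0] := YN NY; last by rewrite X0 inE in xX.
  apply: connect_trans (cS _ _ tX xX); apply: connect1.
  by rewrite adj_inE NY YX tX /= eqxx.
case=> [x|] [y|] xY yY; rewrite ?YX in xY yY => //.
- exact: cS.
- by rewrite connect_adj_in_sym; apply: cN.
- exact: cN.
Qed.

(** On a cycle through the leaf [None], both cyclic neighbours of [None] are [t], so they coincide
    and the cycle has at most two nodes. *)
Lemma tree_add_leaf (T : sgraph) (t : T) : is_tree T -> is_tree (add_leaf t).
Proof.
case=> T0 cT aT; split.
- by rewrite card_option.
- apply: (connected_add_leaf cT) => [x|_]; rewrite ?inE //; by left.
- move=> c cc; have [Nc|Nc] := boolP (None \in c); last first.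
    have [c' cE] : exists c' : seq T, c = map Some c'.
      elim: c Nc {cc} => [|[x|] c IH] //=; first by exists [::].
      rewrite inE /= => /IH[c' ->]; by exists (x :: c').
    rewrite cE size_map; apply: aT; move: cc; rewrite cE => /andP[cc uc].
    have injS : injective (@Some T) by move=> ? ? [].
    rewrite /ucycle -(map_inj_uniq injS) uc andbT.
    case: c' cc {cE uc Nc} => //= x p; rewrite -map_rcons.
    by rewrite path_map.
  have [i p ep] := rot_to Nc; rewrite -(size_rot i) ep.
  move: cc; rewrite -(rot_ucycle i) ep => /andP[]; rewrite /= rcons_path.
  case: p {ep} => [|[x|] p] //=.
  move=> /andP[/andP[/eqP-> _]].
  case: (lastP p) => // q y; rewrite last_rcons.
  case: y => [y|] // /eqP -> /and3P[_]; by rewrite mem_rcons inE eqxx.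
Qed.

(** A tree decomposition of [G[X]]; [w] bounds the bag sizes themselves, without the subtraction of
    one in [width]. *)
Record partial_decomposition (G T : sgraph) (X : {set G}) (w : nat)
    (bag : T -> {set G}) : Prop := PartialDecomposition {
  pd_tree : is_tree T;
  pd_sub : forall t, bag t \subset X;
  pd_card : forall t, #|bag t| <= w;
  pd_vertex : forall v, v \in X -> exists t, v \in bag t;
  pd_edge : {in X &, forall u v, adj u v ->
    exists t, (u \in bag t) && (v \in bag t)};
  pd_connected : forall v, connected_in [set t | v \in bag t]
}.

(* Every edge of G[X :|: U] lies in G[X] or in G[U]. *)
Definition edges_split (G : sgraph) (X U : {set G}) : Prop :=
  {in X & U, forall x y, adj x y -> (x \in U) || (y \in X)}.

(** A vertex shared by [X] and [B] lies in [bag t], so its nodes stay connected; [edges_split]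
    excludes edges between [X :\: B] and [B :\: X], which no bag would cover. *)
Lemma partial_decomposition_add_leaf (G T : sgraph) (X B : {set G}) (w : nat)
    (bag : T -> {set G}) (t : T) :
  partial_decomposition X w bag -> X :&: B \subset bag t -> #|B| <= w ->
  edges_split X B ->
  partial_decomposition (T := add_leaf t) (X :|: B) w (oapp bag B).
Proof.
move=> [tT sX cw vX eX cX] XBt Bw sp; split=> //.
- exact: tree_add_leaf.
- by case=> [s|] /=; rewrite ?subsetUr // (subset_trans (sX s)) ?subsetUl.
- by case.
- move=> v; rewrite inE => /orP[/vX[s vs]|vB]; [by exists (Some s)|by exists None].
- have eXs x y : x \in X -> y \in X -> adj x y ->
    exists t' : add_leaf t, (x \in oapp bag B t') && (y \in oapp bag B t').
    by move=> xX yX /(eX _ _ xX yX)[s xys]; exists (Some s).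
  have eXB x y : x \in X -> y \in B -> adj x y ->
    exists t' : add_leaf t, (x \in oapp bag B t') && (y \in oapp bag B t').
    move=> xX yB xy; have /orP[xB|yX] := sp _ _ xX yB xy; last exact: eXs.
    by exists None; rewrite /= xB yB.
  move=> x y; rewrite !inE => /orP[xX|xB] /orP[yX|yB] xy.
  + exact: eXs.
  + exact: eXB.
  + by have [|s] := eXB _ _ yX xB; [rewrite adj_sym|exists s; rewrite andbC].
  + by exists None; rewrite /= xB yB.
- move=> v; apply: (connected_add_leaf (cX v)) => [s|]; rewrite !inE // => vB.
  have [vX0|vX0] := boolP (v \in X).
    by left; apply: (subsetP XBt); rewrite inE vX0.
  right; apply/setP=> s; rewrite !inE; apply: contraNF vX0.
  exact: (subsetP (sX s)).
Qed.

(** * From breakability to bounded treewidth *)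

Lemma exists_subset_card (T : finType) (W U : {set T}) (n : nat) :
  W \subset U -> #|W| <= n <= #|U| ->
  exists V : {set T}, [/\ W \subset V, V \subset U & #|V| = n].
Proof.
move=> sWU /andP[Wn]; rewrite -(subnK Wn); elim: (n - #|W|) => [|i IH].
  by exists W.
rewrite addSn => iU; have [V [WV VU Vi]] := IH (ltnW iU).
have [x xU xV] : exists2 x, x \in U & x \notin V.
  by apply/subsetPn; apply: contraL iU => /subset_leq_card; rewrite Vi -leqNgt.
exists (x |: V); split; first by rewrite subsetU // WV orbT.
  by rewrite subUset sub1set xU.
by rewrite cardsU1 xV Vi.
Qed.

(** The last clause, survival of every old bag, is what lets the second recursive call find a node
    with bag [Q] after the first side has been added. *)
Lemma extend_decomposition (G : sgraph) (n k : nat) :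
  (forall W : {set G}, n <= #|W| -> exists S A B : {set G},
    [/\ #|S| <= k, A \subset W :\: S, B \subset W :\: S, k < #|A| & k < #|B|]
    /\ {in A & B, forall a b, ~~ connect (adj_in (~: S)) a b}) ->
  forall (U X : {set G}) (T : sgraph) (bag : T -> {set G}) (t : T),
    partial_decomposition X (n + k) bag -> X :&: U \subset bag t ->
    #|X :&: U| <= n -> edges_split X U ->
  exists (T' : sgraph) (bag' : T' -> {set G}),
    partial_decomposition (X :|: U) (n + k) bag' /\
    forall s, exists s', bag' s' = bag s.
Proof.
move=> brk U; have [j] := ubnP #|U|; elim: j U => // j IH U Uj X T bag t pX XUt.
move=> XUn sp; have [Un|nU] := leqP #|U| n.
  exists (add_leaf t), (oapp bag U); split; last by move=> s; exists (Some s).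
  by apply: partial_decomposition_add_leaf => //; rewrite (leq_trans Un) ?leq_addr.
have [W [XUW WU Wn]] :
    exists W : {set G}, [/\ X :&: U \subset W, W \subset U & #|W| = n].
  by apply: exists_subset_card; rewrite ?subsetIr // XUn ltnW.
have [|S [A [B [[Sk AW BW Ak Bk] sepAB]]]] := brk W; first by rewrite Wn.
(* [R] is the union of the components of [G - S] that meet [A], so no edge joins [V1] to [V2]. *)
pose R := [set y | [exists a in A, connect (adj_in (~: S)) a y]].
pose S' := S :&: U; pose V1 := (U :\: S) :&: R; pose V2 := (U :\: S) :\: R.
have S'k : #|S'| <= k by rewrite (leq_trans (subset_leq_card (subsetIl _ _))).
have AU : A \subset U :\: S by rewrite (subset_trans AW) ?setSD.
have BU : B \subset U :\: S by rewrite (subset_trans BW) ?setSD.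
have AV1 : A \subset V1.
  rewrite subsetI AU; apply/subsetP=> a aA; rewrite inE.
  by apply/existsP; exists a; rewrite aA connect0.
have BV2 : B \subset V2.
  rewrite subsetD BU; apply/pred0P=> b /=; apply/negP=> /andP[bB].
  rewrite inE => /existsP[a /andP[aA ab]].
  by have := sepAB _ _ aA bB; rewrite ab.
have V12 x y : x \in V1 -> y \in V2 -> adj x y = false.
  move=> /setIP[/setDP[_ xS]]; rewrite inE => /existsP[a /andP[aA ax]].
  move=> /setDP[/setDP[_ yS] yR]; apply: contraNF yR => xy; rewrite inE.
  apply/existsP; exists a; rewrite aA (connect_trans ax) // connect1 //.
  by rewrite adj_inE !inE xS yS.
have UE x : x \in U -> [|| x \in S', x \in V1 | x \in V2].
  move=> xU; rewrite !(in_setI, in_setD) xU /=.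
  by case: (x \in S) => //=; case: (x \in R).
(* [Y] is general because the second side is added to a part that already contains the first. *)
have split_side (Y V V' : {set G}) : X \subset Y -> Y \subset X :|: U ->
    S' \subset Y -> V \subset U ->
    (forall x, x \in U -> [|| x \in S', x \in V | x \in V']) ->
    (forall x y, x \in V -> y \in V' -> adj x y = false) ->
    edges_split Y (V :|: S').
  move=> XY YXU SY VU UE' VV' x y xY; rewrite in_setU => /orP[yV|yS]; last first.
    by move=> _; rewrite (subsetP SY _ yS) orbT.
  move=> xy; have yU := subsetP VU _ yV.
  have : (x \in U) || (y \in Y).
    have /setUP[xX|->//] := subsetP YXU _ xY.
    by have /orP[->//|/(subsetP XY)->] := sp _ _ xX yU xy; rewrite orbT.
  case/orP=> [xU|->]; last by rewrite orbT.
  have /or3P[xS|xV|xV'] := UE' _ xU; rewrite in_setU ?xS ?xV ?orbT //.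
  by move: xy; rewrite adj_sym VV'.
pose Q := W :|: S'.
have WQ : W \subset Q by apply: subsetUl.
have QU : Q \subset U by rewrite subUset WU subsetIr.
have XQ : X :&: Q \subset X :&: U by apply: setIS.
have pQ : partial_decomposition (T := add_leaf t) (X :|: Q) (n + k) (oapp bag Q).
  apply: partial_decomposition_add_leaf => //; first exact: subset_trans XUt.
    by rewrite (leq_trans (leq_card_setU _ _)) // Wn leq_add2l.
  move=> x y xX yQ xy.
  have /orP[xU|->] := sp _ _ xX (subsetP QU _ yQ) xy; last by rewrite orbT.
  by rewrite (subsetP WQ) // (subsetP XUW) // inE xX.
(* A side [V] misses more than [k] vertices of [W], which pays for adding [S']. *)
have small_side (V C : {set G}) : C \subset W -> k < #|C| -> [disjoint C & V :|: S'] ->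
    #|Q :&: (V :|: S')| <= n.
  move=> CW Ck CV; apply: (@leq_trans #|(W :\: C) :|: S'|).
    apply: subset_leq_card; apply/subsetP=> x /setIP[/setUP[xW|xS] xVS].
      by apply/setUP; left; rewrite in_setD xW (disjointFl CV).
    by apply/setUP; right.
  rewrite (leq_trans (leq_card_setU _ _)) // cardsD (setIidPr CW) Wn.
  have Cn : #|C| <= n by rewrite -Wn subset_leq_card.
  by rewrite -[leqRHS](subnK Cn) leq_add2l (leq_trans S'k) // ltnW.
have subW (C : {set G}) : C \subset W :\: S -> C \subset W by rewrite subsetD => /andP[].
have V1U : V1 \subset U := subset_trans (subsetIl _ _) (subsetDl _ _).
have V2U : V2 \subset U := subset_trans (subsetDl _ _) (subsetDl _ _).
have dis (C V V' : {set G}) : C \subset U :\: S -> C \subset V -> [disjoint V & V'] ->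
    [disjoint C & V' :|: S'].
  move=> CU CV dV; apply/pred0P=> x /=; apply/negP=> /andP[xC].
  case/setUP=> [xV'|/setIP[xS _]].
    by have := subsetP CV x xC; rewrite (disjointFl dV).
  by have := subsetP CU x xC; rewrite in_setD xS.
have dV12 : [disjoint V1 & V2].
  apply/pred0P=> x /=; rewrite inE [x \in V2]inE.
  by case: (x \in R); rewrite /= ?andbF.
have dB := dis B V2 V1 BU BV2; rewrite disjoint_sym in dB; have {}dB := dB dV12.
have dA := dis A V1 V2 AU AV1 dV12.
(* The recursion decreases because [C], taken from the opposite side, is left out. *)
have smaller (V C : {set G}) : V \subset U -> C \subset U -> k < #|C| ->
    [disjoint C & V :|: S'] -> #|V :|: S'| < j.
  move=> VU CU Ck dC; rewrite -ltnS (leq_trans _ Uj) // ltnS proper_card //.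
  rewrite properE subUset VU subsetIr /=.
  have /card_gt0P[c cC] : 0 < #|C| by apply: leq_ltn_trans Ck.
  apply/subsetPn; exists c; first exact: (subsetP CU).
  by rewrite (disjointFr dC).
(* Since [X :&: U] lies in [W], the part [X] adds nothing to the interface beyond [Q]. *)
have capQ (V : {set G}) : V \subset U -> (X :|: Q) :&: (V :|: S') = Q :&: (V :|: S').
  move=> VU; apply/setP=> x; rewrite !in_setI in_setU.
  have [xV|] := boolP (x \in V :|: S'); rewrite ?andbF // !andbT.
  have [xX|//] := boolP (x \in X); rewrite /= (subsetP WQ) // (subsetP XUW) //.
  by rewrite inE xX; move: (x) xV {xX}; apply/subsetP; rewrite subUset VU subsetIr.
have [||||T1 [bag1 [p1 ex1]]] := IH (V1 :|: S') _ (X :|: Q) (add_leaf t) _ None pQ.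
- by apply: (smaller _ B); rewrite // (subset_trans BU) ?subsetDl.
- by rewrite capQ // subsetIl.
- by rewrite capQ //; apply: (small_side _ B) => //; apply: subW.
- apply: (split_side _ _ V2) => //; rewrite ?subsetUl ?setUS //.
  by rewrite (subset_trans _ (subsetUr _ _)) // subsetUr.
have [q qE] := ex1 None; rewrite /= in qE.
have capQ2 : (X :|: Q :|: (V1 :|: S')) :&: (V2 :|: S') = Q :&: (V2 :|: S').
  rewrite setIUl capQ //; apply/setUidPl.
  apply/subsetP=> x /setIP[xV1 xV2]; apply/setIP; split=> //; apply/setUP; right.
  case/setUP: xV1 => // xV1; case/setUP: xV2 => // xV2.
  by have := disjointFr dV12 xV1; rewrite xV2.
have [||||T2 [bag2 [p2 ex2]]] := IH (V2 :|: S') _ _ _ _ q p1.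
- by apply: (smaller _ A); rewrite // (subset_trans AU) ?subsetDl.
- by rewrite capQ2 qE subsetIl.
- by rewrite capQ2; apply: (small_side _ A) => //; apply: subW.
- apply: (split_side _ _ V1) => //; rewrite -?setUA ?subsetUl ?setUS //.
  + by rewrite !subUset WU V1U !subsetIr.
  + by rewrite !setUA subsetUr.
  + by move=> x /UE; rewrite [in X in _ || X]orbC.
  + by move=> x y xV yV; rewrite adj_sym V12.
exists T2, bag2; split; last first.
  move=> s; have [s1 s1E] := ex1 (Some s); have [s2 s2E] := ex2 s1.
  by exists s2; rewrite s2E s1E.
suff -> : X :|: U = X :|: Q :|: (V1 :|: S') :|: (V2 :|: S') by [].
rewrite -!setUA; congr (_ :|: _); apply/eqP; rewrite eqEsubset.
rewrite !subUset WU V1U V2U !subsetIr !andbT; apply/subsetP=> x /UE.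
by rewrite !in_setU => /or3P[] ->; rewrite ?orbT.
Qed.

Lemma treewidth_le (G T : sgraph) (bag : T -> {set G}) (w : nat) :
  partial_decomposition [set: G] w bag -> treewidth G <= w.
Proof.
move=> [tT _ cw vX eX cX]; rewrite /treewidth; case: ex_minnP => m _ min.
apply: (@leq_trans (width bag)).
  apply: min; apply/asboolP; exists T, bag; split=> //; split=> // [v|u v uv].
    by apply: vX; rewrite inE.
  by apply: eX; rewrite ?inE.
rewrite /width (leq_trans (leq_pred _)) //; exact/bigmax_leqP.
Qed.

Lemma breakable_bounded_treewidth (C : graph_class) :
  infty_deletion_breakable C -> bounded_treewidth C.
Proof.
case=> N [k brk]; exists (N k.+1 + k) => G CG.
(* The induction starts from one node with an empty bag and takes the whole graph as [U]. *)
pose bag0 (t : one_vertex_graph) : {set G} := set0.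
have p0 : partial_decomposition set0 (N k.+1 + k) bag0.
  split=> [|t|t|v|u v|v]; rewrite ?sub0set ?cards0 ?inE //.
    split; first by rewrite card_unit.
      by move=> [] [] _ _; apply: connect0.
    move=> c /andP[_ /card_uniqP <-].
    by rewrite (leq_trans (max_card _)) ?card_unit.
  by move=> [] [] _ _; apply: connect0.
have [||||T [bag [pT _]]] :=
  @extend_decomposition G (N k.+1) k _ [set: G] _ one_vertex_graph _ tt p0.
- by move=> W; apply: brk.
- by rewrite set0I sub0set.
- by rewrite set0I cards0.
- by move=> x y; rewrite inE.
by rewrite setUT in pT; apply: treewidth_le pT.
Qed.

(** * Branches at a node of a tree *)

(** Otherwise two walks joined at [x] lead from [s] to [t] without the edge between them, and that
    edge closes a simple such path to a cycle. *)
Lemma edge_is_bridge (T : sgraph) (s t x : T) : acyclic T -> adj s t ->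
  connect (adj_in (~: [set t])) s x -> ~~ connect (adj_in (~: [set s])) t x.
Proof.
move=> aT st sx; apply/negP; rewrite connect_adj_in_sym => xt.
pose e := [rel y z : T | [&& adj y z, (y != s) || (z != t) & (y != t) || (z != s)]].
have sub (a b : T) (ab : (a = s /\ b = t) \/ (a = t /\ b = s)) :
    subrel (connect (adj_in (~: [set a]))) (connect e).
  apply: connect_sub => y z; rewrite adj_inE !inE => /and3P[ya za yz].
  apply: connect1; rewrite /= yz /=.
  by case: ab => -[<- <-]; rewrite ya za ?orbT.
have /connectP[p ep tE] : connect e s t.
  apply: connect_trans (sub t s _ _ _ sx) (sub s t _ _ _ xt); tauto.
case/shortenP: ep tE => q eq uq _ tE.
(* Size at most 2 forces the path to be the edge from [s] to [t] itself, which [e] excludes. *)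
have : size (s :: q) <= 2.
  apply: aT; rewrite /ucycle uq andbT /= rcons_path -tE adj_sym st andbT.
  by apply: sub_path eq => y z /and3P[].
case: q eq uq tE => [_ _ tE|y [|//]] /=.
  by rewrite tE adj_irr in st.
by rewrite andbT => /and3P[_ +  _] _ tE; rewrite tE !eqxx.
Qed.

(** The component of [T - t] containing [u]; for [u = t] it degenerates to the singleton of [t]. *)
Definition branch (T : sgraph) (t u : T) : {set T} :=
  [set x | connect (adj_in (~: [set t])) u x].

Lemma exists_neighbour_in_branch (T : sgraph) (t u : T) :
  connected_in [set: T] -> u != t -> exists2 s, s \in branch t u & adj s t.
Proof.
move=> cT; have /connectP[p + tE] := cT u t (in_setT _) (in_setT _).
elim: p u tE => [u -> _|z p IH u tE /=]; first by rewrite eqxx.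
move=> /andP[/and3P[_ _ uz] pz] ut.
have [zt|zt] := eqVneq z t; first by exists u; rewrite -?zt // inE connect0.
have [s sz st] := IH z tE pz zt; exists s => //; move: sz; rewrite !inE.
by apply: connect_trans; apply: connect1; rewrite adj_inE !inE ut zt.
Qed.

(** As the edge between [s] and [t] is a bridge, [T - s] separates [x] from [t]; walks from [x] in
    [T - s] thus avoid [t] and stay in [branch t u]. *)
Lemma branch_subset (T : sgraph) (s t u v x : T) : acyclic T ->
  s \in branch t u -> adj s t -> x \in branch t u -> x \in branch s v ->
  branch s v \subset branch t u.
Proof.
move=> aT; rewrite !inE => us st ux vx.
have tx : ~~ connect (adj_in (~: [set s])) t x.
  apply: edge_is_bridge => //; apply: connect_trans ux.
  by rewrite connect_adj_in_sym.
apply/subsetP=> y; rewrite !inE => vy.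
have xy : connect (adj_in (~: [set s])) x y.
  by apply: connect_trans vy; rewrite connect_adj_in_sym.
apply: connect_trans ux _; case/connectP: xy => p + ->.
elim: p x tx {vx vy} => //= z p IH x tx /andP[xz pz].
have tz : ~~ connect (adj_in (~: [set s])) t z.
  apply: contra tx => tz; apply: connect_trans tz _.
  by rewrite connect_adj_in_sym connect1.
apply: connect_trans (IH z tz pz); apply: connect1.
move: xz; rewrite !adj_inE !inE => /and3P[_ _ ->]; rewrite andbT.
by apply/andP; split; [move: tx|move: tz]; apply: contraNneq => ->; apply: connect0.
Qed.

(** Carrying more than half of [W] enters only through its consequence that any two big sets
    meet. *)
Lemma exists_balanced_node (T : sgraph) (big : {pred {set T}}) : is_tree T ->
  {in big &, forall D D', exists x, x \in D :&: D'} ->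
  exists t, forall u, u != t -> branch t u \notin big.
Proof.
move=> [/card_gt0P[t0 _] cT aT] bigI.
have [/existsP[t /forallP tP]|] :=
    boolP [exists t : T, [forall u : T, (u != t) ==> (branch t u \notin big)]].
  by exists t => u; apply/implyP.
rewrite negb_exists => /forallP no.
have bigP t : exists2 u, u != t & branch t u \in big.
  have := no t; rewrite negb_forall => /existsP[u].
  by rewrite negb_imply negbK => /andP[]; exists u.
pose P (tu : T * T) := (tu.2 != tu.1) && (branch tu.1 tu.2 \in big).
have [u0 u0t b0] := bigP t0; have P0 : P (t0, u0) by apply/andP.
case: (arg_minnP (fun tu : T * T => #|branch tu.1 tu.2|) P0) => -[t u] /=.
move=> /andP[/= ut bu] min.
have [s us st] := exists_neighbour_in_branch cT ut.
have [v vs bv] := bigP s; have [x /setIP[xv xu]] := bigI _ _ bv bu.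
have := min (s, v); rewrite /P /= vs bv => /(_ isT); rewrite leqNgt => /negP[].
apply: proper_card; apply/properP; split.
  exact: branch_subset st xu xv.
(* The inclusion is strict: [s] lies in the larger branch but in no branch at [s] itself with
   [v != s]. *)
exists s => //; rewrite inE; apply: contra vs => vs.
move: vs; rewrite connect_adj_in_sym => /connectP[[|y p] /=]; first by move=> _ ->.
by rewrite adj_inE !inE eqxx.
Qed.

(** * From bounded treewidth to breakability *)

(** A fibre with [m] elements of [W] can serve alone. If there is none, a smallest [P] collecting
    [m] elements collects fewer than [2 * m], unless it is empty and [m] is 0. *)
Lemma split_by_fibres (V T : finType) (f : V -> T) (W : {set V}) (m : nat) :
  3 * m <= #|W| -> (forall y, #|W :&: f @^-1: [set y]| + m <= #|W|) ->
  exists P : {set T}, m <= #|W :&: f @^-1: P| /\ m <= #|W :\: f @^-1: P|.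
Proof.
move=> Wm fW; have cW (P : {set T}) : #|W :&: f @^-1: P| + #|W :\: f @^-1: P| = #|W|.
  exact: cardsID.
have [/existsP[y my]|] := boolP [exists y, m <= #|W :&: f @^-1: [set y]|].
  by exists [set y]; split=> //; have := cW [set y]; have := fW y; lia.
rewrite negb_exists => /forallP small.
have PT : m <= #|W :&: f @^-1: setT|.
  by rewrite preimsetT setIT; lia.
case: (@arg_minnP _ setT (fun P : {set T} => m <= #|W :&: f @^-1: P|)
  (fun P => #|P|) PT) => P mP min.
exists P; split=> //; have [P0|[y yP]] := set_0Vmem P.
  by move: mP; rewrite P0 preimset0 setI0 cards0; lia.
have : #|W :&: f @^-1: (P :\ y)| < m.
  by rewrite ltnNge; apply/negP=> /min; rewrite [#|P|](cardsD1 y) yP add1n ltnn.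
have : #|W :&: f @^-1: P| <=
    #|W :&: f @^-1: [set y]| + #|W :&: f @^-1: (P :\ y)|.
  by rewrite -{1}(setD1K yP) preimsetU setIUr leq_card_setU.
have := small y; rewrite -ltnNge; have := cW P; lia.
Qed.

Lemma bounded_treewidth_breakable (C : graph_class) :
  bounded_treewidth C -> infty_deletion_breakable C.
Proof.
(* The deleted bag has at most [k.+1] vertices: at least [3 * m] elements of [W] survive, and a
   fibre with at most half of [W] misses at least [m] of them. *)
case=> k twk; exists (fun m => 3 * m + 2 * k.+1), k.+1 => m G W CG Wm.
have [T [bag [[tT vT eT cT] wk]]] : exists (T : sgraph) (bag : T -> {set G}),
    tree_decomposition bag /\ width bag <= k.
  have := twk G CG; rewrite /treewidth; case: ex_minnP => w /asboolP.
  by case=> T [bag [td <-]] _ wk; exists T, bag.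
have bagk t : #|bag t| <= k.+1.
  move: wk; rewrite /width -ltnS => /(leq_trans (leqSpred _)).
  by apply: leq_trans; apply: (leq_bigmax t).
(* [beta D] holds the vertices all of whose nodes lie in [D]. Two such sets with majorities of [W]
   share a vertex, and any node of it lies in both [D] and [D']. *)
pose beta (D : {set T}) := [set v | [forall x, (v \in bag x) ==> (x \in D)]].
have [|t tP] := @exists_balanced_node T
    [pred D | #|W| < 2 * #|W :&: beta D|] tT.
  move=> D D'; rewrite !inE => bD bD'.
  have [v] : exists v, v \in (W :&: beta D) :&: (W :&: beta D').
    apply/set0Pn; rewrite -card_gt0; have := cardsUI (W :&: beta D) (W :&: beta D').
    have : #|(W :&: beta D) :|: (W :&: beta D')| <= #|W|.
      by apply: subset_leq_card; rewrite subUset !subsetIl.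
    lia.
  rewrite !inE => /andP[/andP[_ /forallP vD] /andP[_ /forallP vD']].
  have [x vx] := vT v; exists x.
  by have := vD x; have := vD' x; rewrite vx inE /= => -> ->.
(* For [v] outside [bag t], the nodes of [v] are connected in [T - t], so [f v] is one branch at
   [t]; it is constant along edges of [G - bag t]. *)
pose f v := [set u | [exists x, (v \in bag x) && (u \in branch t x)]].
have same_branch v x y : v \notin bag t -> v \in bag x -> v \in bag y ->
    y \in branch t x.
  move=> vt vx vy; rewrite inE; have := cT v x y; rewrite !inE => /(_ vx vy).
  apply: connect_adj_inS; apply/subsetP=> z; rewrite !inE.
  by apply: contraTneq => ->.
have fE v x : v \notin bag t -> v \in bag x -> f v = branch t x.
  move=> vt vx; apply/setP=> u; rewrite inE; apply/existsP/idP.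
    case=> y /andP[vy]; have := same_branch v x y vt vx vy.
    rewrite !inE; exact: connect_trans.
  by exists x; rewrite vx.
have fadj u v : u \notin bag t -> v \notin bag t -> adj u v -> f u = f v.
  by move=> ut vt /eT[x /andP[ux vx]]; rewrite (fE u x) // (fE v x).
have fconn u v : connect (adj_in (~: bag t)) u v -> f u = f v.
  move=> /connectP[p + ->]; elim: p u => //= z p IH u /andP[].
  rewrite adj_inE !inE => /and3P[ut zt uz] /IH <-; exact: fadj.
have cWS : #|W| <= #|W :\: bag t| + k.+1.
  rewrite -(cardsID (bag t) W) addnC leq_add2l.
  by rewrite (leq_trans _ (bagk t)) // subset_leq_card ?subsetIr.
have [||P [mP mP']] := @split_by_fibres _ _ f (W :\: bag t) m.
- by lia.
(* A nonempty fibre belongs to a branch [D] at [t] and lies in [beta D], so the choice of [t] bounds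
   it by half of [W]. *)
- move=> D; suff : 2 * #|(W :\: bag t) :&: f @^-1: [set D]| <= #|W|.
    by set c := #|_ :&: _|; move: Wm cWS; lia.
  have [->|[v]] := set_0Vmem ((W :\: bag t) :&: f @^-1: [set D]).
    by rewrite cards0.
  rewrite !inE => /andP[/andP[vt vW] /eqP fv].
  have [x vx] := vT v; have xt : x != t by apply: contraNneq vt => <-.
  have := tP x xt; rewrite inE -leqNgt; apply: leq_trans; rewrite leq_mul2l /=.
  apply: subset_leq_card; apply/subsetP=> y.
  rewrite !inE => /andP[/andP[yt ->] /eqP fy] /=.
  apply/forallP=> z; apply/implyP=> yz.
  rewrite -(fE v x) // fv -fy (fE y z) // inE; exact: connect0.
exists (bag t), ((W :\: bag t) :&: f @^-1: P), ((W :\: bag t) :\: f @^-1: P).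
split; first by split; rewrite ?subsetIl ?subsetDl.
move=> a b /setIP[_]; rewrite inE => aP /setDP[_]; rewrite inE => bP.
by apply: contra bP => /fconn <-.
Qed.

Theorem theorem18p12 (C : graph_class) :
  bounded_treewidth C <-> infty_deletion_breakable C.
Proof.
split; [exact: bounded_treewidth_breakable|exact: breakable_bounded_treewidth].
Qed.
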